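(* Let $X\in\mathbb{C}^{d\times d}$. Then the Neumann series $\sum_{k=0}^\infty X^k$ is Abel summable to $(I-X)^{-1}$ if and only if $\lambda(X)\subseteq\overline{\mathbb{D}}\setminus\{1\}$.
   Context: $\lambda(X)$ is the set of eigenvalues of $X$; $\mathbb{D}=\{z\in\mathbb{C}:|z|<1\}$ with closure $\overline{\mathbb{D}}$. For a sequence $(A_k)_{k=0}^\infty$ in $\mathbb{C}^{d\times d}$, the series $\sum_{k=0}^\infty A_k$ is Abel summable to $S\in\mathbb{C}^{d\times d}$ if $\sum_{k=0}^\infty A_kx^k$ is conventionally summable (its partial sums converge) for all $x\in(0,1)$ and $\lim_{x\to1^-}\sum_{k=0}^\infty A_kx^k=S$. The assertion that the series is summable to $(I-X)^{-1}$ is understood to include that $I-X$ is invertible. *)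

(* Defs.v *)
From HB Require Import structures.
From mathcomp Require Import all_boot all_order all_algebra.
From mathcomp Require Import all_classical all_reals all_analysis.
From mathcomp Require Import complex.

Set Implicit Arguments.
Unset Strict Implicit.
Unset Printing Implicit Defensive.

Import Order.TTheory GRing.Theory Num.Theory.
Import numFieldNormedType.Exports.

Local Open Scope classical_set_scope.
Local Open Scope ring_scope.
Local Open Scope complex_scope.

(* [R[i]] carries no topology in the libraries, but every numClosedFieldType
   does (the one of its norm). Packaging [R[i]] as a numClosedFieldType makes
   that topology, and the induced one on matrices, available to inference. *)
Definition CC (R : realType) : numClosedFieldType := R[i].

Definition unit_disc (R : realType) : set (CC R) := [set z | `|z| < 1].
Arguments unit_disc R : clear implicits.

(* [eigenvalue] speaks of row eigenvectors, [v *m X = z *: v]; left and right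
   eigenvalues of a square matrix coincide. *)
Definition spectrum (R : realType) (d : nat) (X : 'M[CC R]_d) : set (CC R) :=
  [set z | eigenvalue X z].

Definition power_series (R : realType) (d : nat) (A : nat -> 'M[CC R]_d)
    (x : R) : nat -> 'M[CC R]_d :=
  series (fun k => (x%:C ^+ k : CC R) *: A k).

(* [limn] is the value of the sum only when the series converges; the first
   clause guarantees this on (0, 1), and the filter [1^'-] only looks there. *)
Definition abel_summable (R : realType) (d : nat) (A : nat -> 'M[CC R]_d)
    (S : 'M[CC R]_d) : Prop :=
  (forall x : R, 0 < x < 1 -> cvgn (power_series A x)) /\
  limn (power_series A x) @[x --> 1^'-] --> S.

(* Main.v *)
Require Import Defs.
From HB Require Import structures.
From mathcomp Require Import all_boot all_order all_algebra.
From mathcomp Require Import all_classical all_reals all_analysis.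
From mathcomp Require Import complex.

Set Implicit Arguments.
Unset Strict Implicit.
Unset Printing Implicit Defensive.

Import Order.TTheory GRing.Theory Num.Theory.
Import numFieldNormedType.Exports.

Local Open Scope classical_set_scope.
Local Open Scope ring_scope.

(** For a square matrix [Y] the partial sums of the Neumann series satisfy
    [(1 + Y + .. + Y^(n-1)) (1 - Y) = 1 - Y^n], so everything reduces to the
    question when [Y^n] tends to [0]. The answer ([powers_cvg0]) is: exactly
    when the spectrum of [Y] lies in the open unit disc. An eigenvector of an
    eigenvalue of modulus at least 1 obstructs the convergence. Conversely, by
    Cayley-Hamilton the product of the factors [Y - z], [z] running over the
    eigenvalues with multiplicity, vanishes; the factors are peeled off one at a time, because
    [u_(n+1) = z u_n + v_n] with [|z| < 1] and [v_n] tending to [0] forces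
    [u_n] to tend to [0] ([affine_recurrence_cvg0]).

    The power series of the theorem at [x] is the Neumann series of [x X], and
    the eigenvalues of [x X] are the [x z], [z] an eigenvalue of [X]. If the
    spectrum of [X] lies in the closed disc without 1 then, for [0 < x < 1], that of
    [x X] lies in the open disc, the sum is [(1 - x X)^-1], and it tends to
    [(1 - X)^-1] as [x] tends to [1] since matrix inversion is continuous
    ([cvg_invmx]) and 1 is not an eigenvalue. If on the contrary some
    eigenvalue has [|z| > 1] then [x = 1 / |z|] lies in (0, 1) and the series
    diverges at [x], because [x z] has modulus 1. *)

(** * Contracting recurrences over the complex numbers *)

Section Contraction.
Variable R : realType.

(** From some rank [N] on, [b] is at most [(1 - r) (e / 2)]. As [e / 2] is the
    fixed point of [t -> r t + (1 - r) (e / 2)], the recurrence then yields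
    [a (N + m) <= r ^ m a N + e / 2]. *)
Lemma contraction_cvg0 (r : R) (a b : R^nat) :
  0 <= r < 1 -> (forall n, 0 <= a n) -> (forall n, a n.+1 <= r * a n + b n) ->
  b n @[n --> \oo] --> 0 -> a n @[n --> \oo] --> 0.
Proof.
move=> /andP[r0 r1] a0 ab b0.
have r1' : 0 < 1 - r by rewrite subr_gt0.
apply/cvgr0Pnorm_lt => e e0.
have e20 : 0 < e / 2 by rewrite divr_gt0.
have [N _ bN] : \forall n \near \oo, `|b n| < (1 - r) * (e / 2).
  by apply: (cvgr0_norm_lt _ b0); rewrite mulr_gt0.
have aN m : a (m + N)%N <= r ^+ m * a N + e / 2.
  elim: m => [|m IHm]; first by rewrite expr0 mul1r lerDl ltW.
  rewrite addSn; apply: le_trans (ab _) _.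
  have bm : b (m + N)%N <= (1 - r) * (e / 2).
    by apply: le_trans (ler_norm _) (ltW (bN _ _)); rewrite /= leq_addl.
  apply: le_trans (lerD (ler_wpM2l r0 IHm) bm) _.
  by rewrite exprS mulrDr mulrA -addrA -mulrDl addrC subrKC mul1r addrC.
have rm0 : r ^+ m * a N @[m --> \oo] --> 0.
  rewrite -[X in _ --> X](mul0r (a N)); apply: cvgM; last exact: cvg_cst.
  by apply: cvg_expr; rewrite ger0_norm.
have [M _ rM] := cvgr0_norm_lt _ rm0 _ e20.
exists (M + N)%N => // n /= MNn.
have Nn : (N <= n)%N := leq_trans (leq_addl _ _) MNn.
rewrite ger0_norm// -(subnK Nn).
apply: le_lt_trans (aN _) _; rewrite [ltRHS]splitr ltrD2r.
apply: le_lt_trans (ler_norm _) (rM _ _).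
by rewrite /= leq_subRL// addnC.
Qed.

(** In the order of the complex numbers a positive element is real, so limits in
    [CC R] can be tested with real tolerances. *)
Lemma gt0_CC_real (e : CC R) : 0 < e -> exists2 r : R, 0 < r & e = (r%:C)%C.
Proof.
move=> e0; have e_real : (complex.Re e)%:C%C = e by rewrite RRe_real ?gtr0_real.
by exists (complex.Re e) => //; rewrite -ltcR e_real.
Qed.

Lemma Re_normK (V : normedZmodType (CC R)) (v : V) :
  (complex.Re `|v|)%:C%C = `|v|.
Proof. by rewrite RRe_real ?normr_real. Qed.

Lemma norm_real_complex (x : R) : `|(x%:C)%C : CC R| = (`|x|%:C)%C.
Proof. by rewrite normc_def /= expr0n addr0 sqrtr_sqr. Qed.

Lemma cvg_real_complex (T : Type) (F : set_system T) (FF : Filter F)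
    (u : T -> R) (l : R) :
  u x @[x --> F] --> l ->
  (((u x)%:C)%C : CC R) @[x --> F] --> ((l%:C)%C : CC R).
Proof.
move=> /cvgrPdist_lt ul; apply/cvgrPdist_lt => _ /gt0_CC_real[e e0 ->].
apply: filterS (ul e e0) => x.
by rewrite -rmorphB norm_real_complex ltcR.
Qed.

(** Norms over [CC R] are complex numbers; taking real parts makes the theory of
    real sequences apply to them. *)
Lemma cvg0_Re_norm (V : normedModType (CC R)) (T : Type) (F : set_system T)
    (FF : Filter F) (u : T -> V) :
  (u x @[x --> F] --> 0) <-> (complex.Re `|u x| @[x --> F] --> 0).
Proof.
have Re_ge0 v : 0 <= complex.Re `|v : V| by rewrite -ler0c Re_normK normr_ge0.
split=> [/cvgr0Pnorm_lt u0|/cvgr0Pnorm_lt u0]; apply/cvgr0Pnorm_lt.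
  move=> e e0; have /u0 : 0 < (e%:C)%C :> CC R by rewrite ltcR.
  by apply: filterS => x; rewrite ger0_norm// -Re_normK ltcR.
move=> _ /gt0_CC_real[e e0 ->]; apply: filterS (u0 e e0) => x.
by rewrite ger0_norm// -ltcR Re_normK.
Qed.

Lemma affine_recurrence_cvg0 (V : normedModType (CC R)) (z : CC R)
    (u v : V^nat) :
  `|z| < 1 -> (forall n, u n.+1 = z *: u n + v n) ->
  v n @[n --> \oo] --> 0 -> u n @[n --> \oo] --> 0.
Proof.
move=> z1 uv /cvg0_Re_norm v0; apply/cvg0_Re_norm.
apply: (@contraction_cvg0 (complex.Re `|z|)) v0.
- by rewrite -ler0c -ltcR Re_normK normr_ge0.
- by move=> n; rewrite -ler0c Re_normK normr_ge0.
- move=> n; rewrite -lecR rmorphD rmorphM /= !Re_normK uv -normrZ.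
  exact: ler_normD.
Qed.

(** A boundary point is approached radially by the points [x z], [x < 1]. *)
Lemma closure_unit_disc : closure (unit_disc R) = [set z | `|z| <= 1].
Proof.
apply/seteqP; split=> z /=.
  move=> zcl; apply: contrapT => /negP.
  rewrite -real_ltNge ?real1 ?normr_real// -subr_gt0 => z1.
  have [w []] := zcl _ (nbhsx_ballx z _ z1).
  rewrite /unit_disc /= -ball_normE /= => w1 zw.
  have := ltrD zw w1; rewrite subrK => /(le_lt_trans (ler_normD _ _)).
  by rewrite subrK ltxx.
move=> z1 B Bz.
have xz : ((x%:C)%C : CC R) * z @[x --> (1 : R)^'-] --> z.
  rewrite -[X in _ --> X]mul1r; apply: cvgMr_tmp.
  by apply: cvg_real_complex; exact: cvg_at_left_filter cvg_id.
near (1 : R)^'- => x.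
exists ((x%:C)%C * z); split; last by near: x; exact: xz.
have x0 : 0 < x by near: x; exact: nbhs_left_gt.
have x1 : x < 1 by near: x; exact: nbhs_left_lt.
rewrite /unit_disc /= normrM norm_real_complex (gtr0_norm x0).
apply: (@le_lt_trans _ _ (x%:C)%C); last by rewrite ltcR.
by apply: ler_piMr => //; rewrite ler0c ltW.
Unshelve. all: by end_near.
Qed.

End Contraction.

(** * Limits of matrices *)

Section MatrixLimits.
Variables (K : numFieldType) (T : Type) (F : set_system T) (FF : Filter F).

Lemma cvg_mxP m n (A : T -> 'M[K]_(m, n)) (B : 'M[K]_(m, n)) :
  (A x @[x --> F] --> B) <-> (forall i j, A x i j @[x --> F] --> B i j).
Proof.
split=> [AB i j|AB].
  exact: (cvg_comp _ _ AB (@coord_continuous K m n i j B)).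
move=> S [P BP PS]; rewrite /= /nbhs /=.
have : \forall x \near F, forall ij : 'I_m * 'I_n, P ij.1 ij.2 (A x ij.1 ij.2).
  by apply: filter_forall => -[i j]; exact: (AB i j _ (BP i j)).
by apply: filterS => x xP; apply: PS => i j; exact: (xP (i, j)).
Qed.

Lemma cvg_mulmx m n p (A : T -> 'M[K]_(m, n)) (B : T -> 'M[K]_(n, p))
    (A0 : 'M[K]_(m, n)) (B0 : 'M[K]_(n, p)) :
  A x @[x --> F] --> A0 -> B x @[x --> F] --> B0 ->
  A x *m B x @[x --> F] --> A0 *m B0.
Proof.
move=> /cvg_mxP AA /cvg_mxP BB; apply/cvg_mxP => i j.
under eq_cvg do rewrite mxE; rewrite mxE.
by apply: cvg_big => [|k _]; [exact: add_continuous|exact: cvgM].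
Qed.

Lemma cvg_det n (A : T -> 'M[K]_n) (A0 : 'M[K]_n) :
  A x @[x --> F] --> A0 -> \det (A x) @[x --> F] --> \det A0.
Proof.
move=> /cvg_mxP AA; apply: cvg_big => [|s _]; first exact: add_continuous.
apply: cvgM; first exact: cvg_cst.
by apply: cvg_big => [|i _]; [exact: mul_continuous|exact: AA].
Qed.

Lemma cvg_adj n (A : T -> 'M[K]_n) (A0 : 'M[K]_n) :
  A x @[x --> F] --> A0 -> \adj (A x) @[x --> F] --> \adj A0.
Proof.
move=> AA; apply/cvg_mxP => i j; under eq_cvg do rewrite mxE; rewrite mxE.
apply: cvgM; first exact: cvg_cst.
apply: cvg_det; apply/cvg_mxP => k l.
under eq_cvg do rewrite !mxE; rewrite !mxE.
by move/cvg_mxP : AA; exact.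
Qed.

(** Near [A0] the determinant does not vanish, so there the inverse is given by
    the adjugate formula, whose ingredients are polynomials in the entries. *)
Lemma cvg_invmx n (A : T -> 'M[K]_n) (A0 : 'M[K]_n) : A0 \in unitmx ->
  A x @[x --> F] --> A0 -> invmx (A x) @[x --> F] --> invmx A0.
Proof.
move=> A0u AA; have A0u' := A0u.
rewrite unitmxE unitfE in A0u.
have dAA := cvg_det AA.
have dA0 : \forall x \near F, \det (A x) != 0 by exact: cvgr_neq0 dAA _.
have : (\det (A x))^-1 *: \adj (A x) @[x --> F] --> invmx A0.
  rewrite /invmx A0u'; apply: cvgZ; last exact: cvg_adj.
  exact: cvgV.
apply: cvg_trans; apply: near_eq_cvg.
by apply: filterS dA0 => x dx; rewrite /invmx unitmxE unitfE dx.
Qed.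

End MatrixLimits.

(** * Powers of a matrix and its spectrum *)

Lemma eigenvector_pow (F : fieldType) d (Y : 'M[F]_d) (v : 'rV[F]_d) z :
  v *m Y = z *: v -> forall n, v *m Y ^+ n = z ^+ n *: v.
Proof.
move=> vY; elim=> [|n IHn]; first by rewrite !expr0 mulmx1 scale1r.
by rewrite exprS mulmxA vY -scalemxAl IHn scalerA -exprS.
Qed.

Lemma scale_expmx (F : fieldType) d (X : 'M[F]_d) (c : F) n :
  c ^+ n *: X ^+ n = (c *: X) ^+ n.
Proof.
elim: n => [|n IHn]; first by rewrite !expr0 scale1r.
rewrite !exprS -IHn -[c *: X * _]/(c *: X *m _) -scalemxAl.
by rewrite -[X in _ *: X]/(_ *m _) -scalemxAr scalerA.
Qed.

Lemma eigenvalueZ (F : fieldType) d (X : 'M[F]_d) (c z : F) : c != 0 ->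
  eigenvalue (c *: X) (c * z) = eigenvalue X z.
Proof.
move=> c0; apply/eigenvalueP/eigenvalueP => -[v vX v0]; exists v => //.
  by apply: (scalerI c0); rewrite scalerA -vX -scalemxAr.
by rewrite -scalemxAr vX scalerA.
Qed.

Lemma unitmx_1B (F : fieldType) d (Y : 'M[F]_d) :
  (1%:M - Y \in unitmx) = ~~ eigenvalue Y 1.
Proof.
rewrite unitmxE unitfE; congr (~~ _).
apply/det0P/eigenvalueP => -[v].
  move=> v0; rewrite mulmxBr mulmx1 => /eqP; rewrite subr_eq0 => /eqP vY.
  by exists v; rewrite // -vY scale1r.
by move=> vY v0; exists v; rewrite // mulmxBr mulmx1 vY scale1r subrr.
Qed.

(** One root at a time: for [u_n = Y^n P B], where [P] is the product over the
    remaining roots, [u_(n+1) = z u_n + Y^n (Y - z) P B]. *)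
Lemma mul_roots_cvg0 (R : realType) d (Y : 'M[CC R]_d.+1) (r : seq (CC R))
    (B : 'M[CC R]_d.+1) :
  (forall z, z \in r -> `|z| < 1) ->
  Y ^+ n * ((\prod_(z <- r) (Y - z%:M)) * B) @[n --> \oo]
    --> (0 : 'M[CC R]_d.+1) ->
  Y ^+ n * B @[n --> \oo] --> (0 : 'M[CC R]_d.+1).
Proof.
elim: r B => [|z r IHr] B r1; first by rewrite big_nil mul1r.
rewrite big_cons; set P := \prod_(_ <- _) _ => YB.
apply: IHr => [w wr|]; first by rewrite r1// inE wr orbT.
have z1 : `|z| < 1 by rewrite r1// inE eqxx.
apply: (@affine_recurrence_cvg0 _ _ z (fun n => Y ^+ n * (P * B)) _ z1 _ YB) => n.
rewrite -!mulrA.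
rewrite [(Y - _) * _]mulrBl mulrBr -[z%:M * _]/(z%:M *m _) mul_scalar_mx.
by rewrite -scalerAr addrC subrK exprSr !mulrA.
Qed.

(** If [v Y = z v] with [1 <= |z|] then [v Y^n = z^n v] stays at least as large
    as [v]. Conversely, the product over all roots of the characteristic
    polynomial is [0] by Cayley-Hamilton, and peeling off its factors leaves
    [Y^n] itself. *)
Lemma powers_cvg0 (R : realType) d (Y : 'M[CC R]_d) :
  (Y ^+ n @[n --> \oo] --> (0 : 'M[CC R]_d)) <-> spectrum Y `<=` unit_disc R.
Proof.
split=> [Y0 z /eigenvalueP[v vY v0]|].
  rewrite /unit_disc /=; apply: contrapT => /negP z1.
  have {}z1 : 1 <= `|z| by rewrite real_leNgt ?real1 ?normr_real.
  have : v *m Y ^+ n @[n --> \oo] --> v *m (0 : 'M[CC R]_d).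
    by apply: cvg_mulmx => //; exact: cvg_cst.
  rewrite mulmx0 => /cvgr0_norm_lt /(_ `|v|).
  rewrite normr_gt0 => /(_ v0)[N _ /(_ N (leqnn N))].
  rewrite /= (eigenvector_pow vY) normrZ normrX.
  by move=> /lt_geF; rewrite ler_peMl// exprn_ege1.
(* [Y] can be substituted in polynomials only in positive dimension, where
   the square matrices form a nontrivial ring *)
case: d Y => [Y _|d Y Yspec].
  by under eq_cvg do rewrite thinmx0; exact: cvg_cst.
have [r char_r] := closed_field_poly_normal (char_poly Y).
have r1 z : z \in r -> `|z| < 1.
  move=> zr; apply: Yspec; rewrite /spectrum /= eigenvalue_root_char.
  by rewrite char_r (monicP (char_poly_monic _)) scale1r root_prod_XsubC.
have Y_r : \prod_(z <- r) (Y - z%:M) = 0.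
  rewrite -(Cayley_Hamilton Y) char_r (monicP (char_poly_monic _)) scale1r.
  rewrite rmorph_prod; apply: eq_bigr => z _.
  by rewrite rmorphB /= horner_mx_X horner_mx_C.
have := @mul_roots_cvg0 R d Y r 1 r1; rewrite Y_r mul0r.
have -> : (fun n => Y ^+ n * 0) = (fun=> 0) by apply/funext => n; rewrite mulr0.
have -> : (fun n => Y ^+ n * 1) = (fun n => Y ^+ n).
  by apply/funext => n; rewrite mulr1.
by apply; exact: cvg_cst.
Qed.

(** * The Neumann series *)

Lemma neumann_partial_sum (F : fieldType) d (Y : 'M[F]_d) n :
  (\sum_(0 <= k < n) Y ^+ k) *m (1%:M - Y) = 1%:M - Y ^+ n.
Proof.
elim: n => [|n IHn]; first by rewrite big_nil mul0mx subrr.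
rewrite big_nat_recr //= mulmxDl IHn mulmxBr mulmx1.
rewrite -[Y ^+ n *m Y]/(Y ^+ n * Y) -exprSr.
by rewrite addrA subrK.
Qed.

Lemma neumann_series (R : realType) d (Y : 'M[CC R]_d) :
  spectrum Y `<=` unit_disc R ->
  series (fun k => Y ^+ k) n @[n --> \oo] --> invmx (1%:M - Y).
Proof.
move=> Yspec.
have Yu : 1%:M - Y \in unitmx.
  by rewrite unitmx_1B; apply/negP => /Yspec; rewrite /unit_disc /= normr1 ltxx.
have -> : series (fun k => Y ^+ k) =
    (fun n => (1%:M - Y ^+ n) *m invmx (1%:M - Y)).
  by apply/funext => n; rewrite -neumann_partial_sum mulmxK.
have Y0 : 1%:M - Y ^+ n @[n --> \oo] --> (1%:M : 'M[CC R]_d).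
  rewrite -[X in _ --> X]subr0.
  by apply: cvgB; [exact: cvg_cst|exact/powers_cvg0].
have := cvg_mulmx _ Y0 (cvg_cst (invmx (1%:M - Y))).
by rewrite mul1mx => h; exact: h.
Qed.

Theorem corollary4p7 (R : realType) (d : nat) (X : 'M[CC R]_d) :
  (1%:M - X \in unitmx /\
   abel_summable (fun k : nat => X ^+ k) (invmx (1%:M - X)))
  <-> spectrum X `<=` closure (unit_disc R) `\ 1.
Proof.
rewrite closure_unit_disc.
have pE (x : R) : power_series (fun k => X ^+ k) x =
    series (fun k => (((x%:C)%C : CC R) *: X) ^+ k).
  by congr series; apply/funext => k; rewrite scale_expmx.
split=> [[Xu [Xcvg _]] z zX|Xspec].
  split; last by move=> z1; move: Xu; rewrite unitmx_1B -z1 zX.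
  rewrite /=; apply: contrapT => /negP z1.
  have {}z1 : 1 < `|z| by rewrite real_ltNge ?real1 ?normr_real.
  (* the series fails to converge where x z has modulus exactly 1 *)
  pose x : R := (complex.Re `|z|)^-1.
  have z0 : 1 < complex.Re `|z| by rewrite -ltcR Re_normK.
  have x01 : 0 < x < 1.
    by rewrite invr_gt0 (lt_trans _ z0)//= invf_lt1// (lt_trans _ z0).
  have xC : (x%:C)%C = `|z|^-1 :> CC R by rewrite -Re_normK; exact: fmorphV.
  have := Xcvg x x01; rewrite pE => /cvg_series_cvg_0/powers_cvg0.
  move=> /(_ ((x%:C)%C * z)); rewrite /spectrum /= eigenvalueZ; last first.
    by rewrite xC invr_eq0 normr_eq0 -normr_gt0 (lt_trans _ z1).
  move=> /(_ zX); rewrite /unit_disc /= xC normrM normfV normr_id mulVf ?ltxx//.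
  by rewrite normr_eq0 -normr_gt0 (lt_trans _ z1).
have Xu : 1%:M - X \in unitmx.
  by rewrite unitmx_1B; apply/negP => /Xspec[_]; exact.
have sumx (x : R) : 0 < x < 1 ->
    power_series (fun k => X ^+ k) x n @[n --> \oo]
      --> invmx (1%:M - ((x%:C)%C : CC R) *: X).
  move=> /andP[x0 x1]; rewrite pE; apply: neumann_series => z zX.
  have xC0 : (x%:C)%C != 0 :> CC R by rewrite gt_eqF// ltcR.
  have /Xspec[/= z1 _] : spectrum X ((x%:C)%C^-1 * z).
    by rewrite /spectrum /= -(eigenvalueZ _ _ xC0) mulVKf.
  move: z1; rewrite normrM normfV norm_real_complex (gtr0_norm x0).
  rewrite ler_pdivrMl; last by rewrite ltcR.
  by rewrite mulr1 => z1; apply: le_lt_trans z1 _; rewrite ltcR.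
split; first exact: Xu.
split=> [x x01|]; first exact: cvgP (sumx x x01).
have : invmx (1%:M - ((x%:C)%C : CC R) *: X) @[x --> (1 : R)^'-]
    --> invmx (1%:M - X).
  apply: cvg_invmx => //; apply: cvgB; first exact: cvg_cst.
  rewrite -[X in _ --> X]scale1r; apply: cvgZr_tmp.
  by apply: cvg_real_complex; exact: cvg_at_left_filter cvg_id.
apply: cvg_trans; apply: near_eq_cvg; near=> x.
apply/esym/cvg_lim; first exact: norm_hausdorff.
apply: sumx; apply/andP; split; near: x.
  by apply: nbhs_left_gt.
by apply: nbhs_left_lt.
Unshelve. all: by end_near.
Qed.
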